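(* Let $\Lambda$ be a finite box of a $d$-dimensional lattice (for instance $\mathbb{Z}^d$), let $\beta>0$, $\Delta>0$ and $\Gamma\ge 0$, and consider the random Hamiltonian on spin configurations $\sigma\in\{-1,1\}^\Lambda$ $$H_\Lambda(\sigma) = -\sum_{\substack{i,j\in\Lambda\\ |i-j|=1}} J_{i,j}\,\sigma_i\sigma_j-\sum_{i\in\Lambda}h_i\sigma_i ,$$ where the $J_{i,j}$ are i.i.d. centered Gaussian random variables with variance $\Delta^2$, the $h_i$ are i.i.d. centered Gaussian random variables with variance $\Gamma^2$, and the families $(h_i)$ and $(J_{i,j})$ are mutually independent. Let $\omega$ denote the random Boltzmann-Gibbs expectation at inverse temperature $\beta$ and $\mathrm{Av}$ the expectation over the Gaussian variables, and write $\sigma_{i,j}=\sigma_i\sigma_j$. Then for all $i,j\in\Lambda$ with $|i-j|=1$ and all $k,l\in\Lambda$ with $|k-l|=1$, independently of the distance between the two bonds, $$\mathrm{Av}\left(\omega^2(\sigma_{i,j}\sigma_{k,l})\right)\;\ge\; 1-\frac{b_1}{\beta}-\frac{b_3}{\beta^3},\qquad\text{where}\quad b_1=\frac{2}{\Delta}\sqrt{\frac{2}{\pi}},\quad b_3=\frac{1}{\sqrt{2\pi}\,\Delta^3}.$$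
   Context: Here $|i-j|=1$ means that $i$ and $j$ are nearest neighbours in the lattice; each nearest-neighbour bond $\{i,j\}$ carries one coupling $J_{i,j}$ and contributes one term to the sum. A Gaussian variable of variance $0$ is identically $0$. For a function $f$ of the spin configuration and a given realization of the couplings, $\omega(f)=\dfrac{\sum_{\sigma} f(\sigma)e^{-\beta H_\Lambda(\sigma)}}{\sum_{\sigma}e^{-\beta H_\Lambda(\sigma)}}$, the sums running over $\sigma\in\{-1,1\}^\Lambda$; $\omega^2(f)$ means $(\omega(f))^2$. *)

(* Defs.v *)
From HB Require Import structures.
From mathcomp Require Import all_boot all_order all_algebra finmap.
From mathcomp Require Import all_classical all_reals all_analysis.

Set Implicit Arguments.
Unset Strict Implicit.
Unset Printing Implicit Defensive.

Import Order.TTheory GRing.Theory Num.Theory.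
Import numFieldNormedType.Exports.

Local Open Scope classical_set_scope.
Local Open Scope ring_scope.

Section Lattice.
Variables (R : realType) (d : nat).
Implicit Types (B E : 'M[R]_d) (a b x y : 'rV[R]_d).

(* Euclidean norm: the library norm of a row vector is the sup norm. *)
Definition enorm x : R := Num.sqrt (\sum_(k < d) x 0 k ^+ 2).

(* Integer combinations of the rows of B. *)
Definition lattice B : set 'rV[R]_d :=
  [set x | exists z : 'rV[int]_d, x = map_mx intr z *m B].

(* Distances in L are measured in units of the nearest-neighbour spacing, so
   that two points are nearest neighbours exactly when their distance is 1. *)
Definition unit_spacing (L : set 'rV[R]_d) : Prop :=
  forall x y, L x -> L y -> x != y -> 1 <= enorm (x - y).

(* The box a_k <= t_k <= b_k, the t_k being coordinates along the rows of E:
   E = 1 gives a Cartesian box, E = B a box with edges along the basis of the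
   lattice. *)
Definition box E a b : set 'rV[R]_d :=
  [set x | exists2 t : 'rV[R]_d,
     (forall k, a 0 k <= t 0 k <= b 0 k) & x = t *m E].

End Lattice.

Section Model.
Variables (R : realType) (d : nat) (Lambda : {fset 'rV[R]_d}).

Definition neighbours (i j : Lambda) : bool := enorm (val i - val j) == 1.

(* A bond is an unordered pair of neighbouring sites. *)
Definition is_bond (e : {set Lambda}) : bool :=
  [exists i, exists j, neighbours i j && (e == [set i; j]%SET)].

Definition bond := {e : {set Lambda} | is_bond e}.

Definition config := {ffun Lambda -> bool}.

Definition spin (s : config) (i : Lambda) : R := if s i then 1 else -1.

Definition hamiltonian (J : bond -> R) (h : Lambda -> R) (s : config) : R :=
  - (\sum_(e : bond) J e * \prod_(i in val e) spin s i)
  - \sum_(i : Lambda) h i * spin s i.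

Definition gibbs (beta : R) (J : bond -> R) (h : Lambda -> R)
    (f : config -> R) : R :=
  (\sum_(s : config) f s * expR (- beta * hamiltonian J h s)) /
  (\sum_(s : config) expR (- beta * hamiltonian J h s)).

End Model.

Section Probability.
Variables (R : realType) (disp : measure_display) (T : measurableType disp).
Variable P : probability T R.

(* [normal_prob 0 0] is a junk value in the library (uniform on [0, 1]);
   variance 0 is the point mass at 0. *)
Definition centered_gaussian (s : R) (X : {RV P >-> R}) : Prop :=
  forall A : set R, measurable A ->
    distribution P X A = if s == 0 then \d_(0 : R) A else normal_prob 0 s A.

Definition mutually_independent (I : finType) (X : I -> {RV P >-> R}) : Prop :=
  forall (S : {set I}) (A : I -> set R), (forall i, measurable (A i)) ->
    P (\bigcap_(i in [set` S]) (X i @^-1` A i)) =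
    (\prod_(i in S) P (X i @^-1` A i))%E.

Definition join_families (I K : finType) (X : I -> {RV P >-> R})
    (Y : K -> {RV P >-> R}) (x : I + K) : {RV P >-> R} :=
  match x with inl i => X i | inr k => Y k end.

End Probability.

(* Main.v *)
Require Import Defs.
From HB Require Import structures.
From mathcomp Require Import all_boot all_order all_algebra finmap.
From mathcomp Require Import all_classical all_reals all_analysis.
From mathcomp Require Import measurable_realfun ring lra.

Set Implicit Arguments.
Unset Strict Implicit.
Unset Printing Implicit Defensive.

Import Order.TTheory GRing.Theory Num.Theory.
Import numFieldNormedType.Exports.

Local Open Scope classical_set_scope.
Local Open Scope ring_scope.

(* For signs A, B one has Var(AB) <= Var(A) + Var(B) under any probability, so
   it suffices to bound Av(1 - omega(s_e)^2) for a single bond e. Singling out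
   the coupling of e, omega(s_e) = tanh (beta J_e + Y) with Y a function of the
   other couplings and of the fields, hence independent of J_e. Since the
   Gaussian density is at most 1/(Delta sqrt(2 pi)) and sech^2 has integral 2,
   Av(1 - omega(s_e)^2) <= 2/(beta Delta sqrt(2 pi)) = b1/(2 beta); the term in
   b3 is pure slack. *)

(** * The logistic function and the total integral of its derivative *)

Section Logistic.
Variable R : realType.
Implicit Types t c y x : R.

Definition logistic t : R := (1 + expR (- t))^-1.

(** Equal to sech^2 (t/2) / 4, so that [4 * logistic_deriv (2 * t)] is 1 - tanh^2 t. *)
Definition logistic_deriv t : R := logistic t * (1 - logistic t).

Lemma logistic_den_gt0 t : 0 < 1 + expR (- t).
Proof. by rewrite addr_gt0 ?expR_gt0. Qed.

Lemma logisticN t : logistic (- t) = 1 - logistic t.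
Proof.
rewrite /logistic opprK expRN.
have := expR_gt0 t; set v := expR t => v0; field.
by rewrite !gt_eqF ?addr_gt0.
Qed.

Lemma logistic_gt0 t : 0 < logistic t.
Proof. by rewrite invr_gt0 logistic_den_gt0. Qed.

Lemma logistic_deriv_ge0 t : 0 <= logistic_deriv t.
Proof. by rewrite /logistic_deriv -logisticN mulr_ge0// ltW// logistic_gt0. Qed.

Lemma logistic_derivN t : logistic_deriv (- t) = logistic_deriv t.
Proof. by rewrite /logistic_deriv logisticN subKr mulrC. Qed.

Lemma is_derive_logistic t : is_derive t 1 logistic (logistic_deriv t).
Proof.
have h := lt0r_neq0 (logistic_den_gt0 t).
rewrite /logistic_deriv /logistic.
have dv : is_derive t 1 (fun x => 1 + expR (- x)) (- expR (- t)).
  by apply: is_derive_eq; rewrite /GRing.scale /=; ring.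
apply: is_derive_eq.
rewrite /GRing.scale /=.
by field.
Qed.

Lemma continuous_logistic : continuous logistic.
Proof.
move=> t; apply/differentiable_continuous/derivable1_diffP.
by have [] := is_derive_logistic t.
Qed.

Lemma continuous_logistic_deriv : continuous logistic_deriv.
Proof.
move=> t; apply: cvgM; first exact: continuous_logistic.
by apply: cvgB; [exact: cvg_cst|exact: continuous_logistic].
Qed.

Lemma cvg_logistic_pinfty : logistic t @[t --> +oo] --> (1 : R).
Proof.
have h : 1 + expR (- t) @[t --> +oo] --> (1 + 0 : R).
  by apply: cvgD; [exact: cvg_cst|exact: cvgr_expR].
by rewrite -[X in _ --> X]invr1; apply: cvgV; rewrite ?oner_neq0// -[X in _ --> X]addr0.
Qed.

Local Notation mu := lebesgue_measure.

(** Fundamental theorem of calculus on a half-line: the primitive [c^-1 * logistic (c * x + y)]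
    tends to [c^-1] at infinity. *)
Lemma integral_logistic_deriv_itvcy c y : 0 < c ->
  (\int[mu]_(x in `[0%R, +oo[) (logistic_deriv (c * x + y))%:E = ((1 - logistic y) / c)%:E)%E.
Proof.
move=> c0.
pose F x := c^-1 * logistic (c * x + y).
have dF x : is_derive x 1 F (logistic_deriv (c * x + y)).
  have d1 := is_derive_logistic (c * x + y).
  have d2 : is_derive x 1 (fun x => c * x + y) c.
    by apply: is_derive_eq; rewrite /GRing.scale /=; ring.
  have d3 := @is_derive1_comp R logistic (fun x => c * x + y) x _ _ d1 d2.
  apply: is_derive_eq.
  by rewrite /GRing.scale /=; field; rewrite gt_eqF.
have caff : continuous (fun x => c * x + y).
  by move=> x; apply: cvgD; [exact: cvgMr|exact: cvg_cst].
rewrite (@ge0_continuous_FTC2y R _ F 0 c^-1).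
- by rewrite /F mulr0 add0r -EFinB; congr EFin; ring.
- by move=> x _; exact: logistic_deriv_ge0.
- apply: continuous_subspaceT => x.
  by apply: (@continuous_comp _ _ _ (fun x => c * x + y));
    [exact: caff|exact: continuous_logistic_deriv].
- rewrite -[X in _ --> X]mulr1; apply: cvgM; first exact: cvg_cst.
  apply: cvg_comp cvg_logistic_pinfty.
  apply/cvgryPge => A; near=> x.
  rewrite -lerBlDr -ler_pdivrMl//; near: x.
- by move=> x _; have [] := dF x.
- apply: cvg_at_right_filter; apply/differentiable_continuous/derivable1_diffP.
  by have [] := dF 0.
- by move=> x _; rewrite derive1E; exact: (@derive_val _ _ _ _ _ _ _ (dF x)).
Unshelve. all: by end_near.
Qed.

(** The line is cut at 0 and the negative half is reflected; since the integrand is even up to the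
    sign of [y], the two halves give [(1 - logistic y) / c] and [logistic y / c]. *)
Lemma integral_logistic_deriv c y : 0 < c ->
  (\int[mu]_x (logistic_deriv (c * x + y))%:E = c^-1%:E)%E.
Proof.
move=> c0.
have cb z : continuous (fun x => logistic_deriv (c * x + z)).
  move=> x; apply: (@continuous_comp _ _ _ (fun x => c * x + z));
    last exact: continuous_logistic_deriv.
  by apply: cvgD; [exact: cvgMr|exact: cvg_cst].
have mb z D : measurable_fun D (fun x => (logistic_deriv (c * x + z))%:E).
  apply: measurable_funTS; apply/measurable_EFinP.
  exact: continuous_measurable_fun.
rewrite -set_itvNyy (@itv_bndbnd_setU _ _ _ (BRight 0))//.
rewrite ge0_integral_setU//=; last 3 first.
- exact: mb.
- by move=> x _; rewrite lee_fin logistic_deriv_ge0.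
- by apply/disj_setPS => x /=; rewrite !in_itv/= andbT => -[]; case: ltgtP.
rewrite integral_itv_obnd_cbnd// integral_logistic_deriv_itvcy//.
(* The endpoint 0 is written as -0 to match the substitution x -> -x. *)
rewrite -[in `]-oo, 0]]oppr0 ge0_integration_by_substitutionNy; last 2 first.
- exact: continuous_subspaceT.
- by move=> x _; exact: logistic_deriv_ge0.
under eq_integral do rewrite /= mulrN -[X in logistic_deriv X]opprK logistic_derivN opprD opprK.
rewrite integral_logistic_deriv_itvcy// logisticN -EFinD; congr EFin.
by ring.
Qed.

End Logistic.

(** * Independence of one variable from the sigma-algebra generated by the others *)

Section Independence.
Variables (R : realType) (disp : measure_display) (T : measurableType disp).
Variable P : probability T R.

Section Pair.
Context d1 d2 {T1 : measurableType d1} {T2 : measurableType d2}.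
Variables (X : {RV P >-> T1}) (Y : {RV P >-> T2}).
Hypothesis XY : forall A B, measurable A -> measurable B ->
  P (X @^-1` A `&` Y @^-1` B) = (P (X @^-1` A) * P (Y @^-1` B))%E.

(** The law of the pair agrees with the product of the marginal laws on rectangles, hence
    everywhere; Tonelli then gives the iterated integral. *)
Lemma integral_indep_pair (f : T1 * T2 -> \bar R) :
  measurable_fun setT f -> (forall z, (0 <= f z)%E) ->
  (\int[P]_w f (X w, Y w) =
   \int[distribution P Y]_y \int[distribution P X]_x f (x, y))%E.
Proof.
move=> mf f0.
have mXY : measurable_fun setT (fun w => (X w, Y w)).
  by apply: measurable_fun_pair.
pose XY' : {mfun T >-> (T1 * T2)%type} := HB.pack (fun w => (X w, Y w))
  (isMeasurableFun.Build _ _ _ _ _ mXY).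
rewrite -[LHS](@ge0_integral_distribution _ _ _ _ _ P XY')//.
rewrite -fubini_tonelli2//.
apply: eq_measure_integral => A mA _.
apply/esym.
apply: (@product_measure_unique _ _ _ _ _ (distribution P X) (distribution P Y)
  (distribution P XY')) => // C D mC mD.
Qed.

End Pair.

Section Family.
Variables (I : finType) (X : I -> {RV P >-> R}).
Hypothesis indX : mutually_independent X.
Variable b : I.

(* The pi-system generating the sigma-algebra of all [X i] with [i != b]. *)
Definition cylinders : set (set T) :=
  [set D | exists2 A : I -> set R, (forall i, measurable (A i)) &
     D = \bigcap_(i in [set i | i != b]) X i @^-1` A i].

Lemma cylinders_setI : setI_closed cylinders.
Proof.
move=> _ _ [A mA ->] [B mB ->].
exists (fun i => A i `&` B i); first by move=> i; exact: measurableI.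
by rewrite -bigcapI.
Qed.

Lemma cylinders_measurable : cylinders `<=` measurable.
Proof.
move=> _ [A mA ->]; apply: fin_bigcap_measurable => [|i _]; first exact: finite_finset.
by rewrite -[X in measurable X]setTI; exact: measurable_funP.
Qed.

Lemma measurable_cylinder i : i != b ->
  measurable_fun [set: g_sigma_algebraType cylinders] (X i).
Proof.
move=> ib _ A mA; rewrite setTI; apply: sub_sigma_algebra.
(* The cylinder that constrains coordinate [i] only. *)
exists (fun k => if k == i then A else setT); first by move=> k; case: ifP.
apply/seteqP; split => [w Aw k _ /=|w /(_ i ib)]; last by rewrite /= eqxx.
by case: eqP => // ->.
Qed.

(** Independence is applied to the whole family, with [C] placed at index [b], and again to the
    family without [b]; the two products differ by the factor at [b]. *)
Lemma cylinder_indep (C : set R) (D : set T) : measurable C -> cylinders D ->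
  P (X b @^-1` C `&` D) = (P (X b @^-1` C) * P D)%E.
Proof.
move=> mC [A mA ->].
pose A' i := if i == b then C else A i.
have mA' i : measurable (A' i) by rewrite /A'; case: ifP.
have := indX [set: I]%SET mA'.
rewrite (bigD1 b)//= /A' eqxx.
under eq_bigr => i /= /andP[_ /negPf ->] do [].
move=> h.
have h2 : P (\bigcap_(i in [set` (~: [set b])%SET]) X i @^-1` A i) =
    (\prod_(i in [set: I]%SET | i != b) P (X i @^-1` A i))%E.
  by rewrite indX//; apply: eq_bigl => i; rewrite finset.in_setT !inE.
have e : [set` (~: [set b])%SET] = [set i | i != b].
  by apply/seteqP; split=> i /=; rewrite !inE.
rewrite -e h2 -h; congr (P _).
apply/seteqP; split => [w [Cw Dw] i _|w H].
  rewrite /=; case: eqP => [->//|/eqP ib].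
  by have := Dw i; rewrite /= !inE; exact.
split; first by have := H b; rewrite /= eqxx; apply; rewrite inE.
by move=> i /=; rewrite !inE => /negPf ib; have := H i; rewrite /= ib; apply; rewrite inE.
Qed.

(** As functions of [D], both sides are finite measures: [P] restricted to the event on [X b], and
    [P] scaled by the probability of that event. They agree on the pi-system [cylinders], hence on
    the sigma-algebra it generates. *)
Lemma sigma_indep (C : set R) (D : set T) : measurable C -> <<s cylinders >> D ->
  P (X b @^-1` C `&` D) = (P (X b @^-1` C) * P D)%E.
Proof.
move=> mC.
have mXC : measurable (X b @^-1` C).
  by rewrite -[X in measurable X]setTI; exact: measurable_funP.
pose k := NngNum (fine_ge0 (measure_ge0 P (X b @^-1` C))).
have Pk A : mscale k P A = (P (X b @^-1` C) * P A)%E.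
  by rewrite /mscale /= fineK// fin_num_measure.
move=> sD; rewrite -Pk setIC.
apply: (@g_sigma_algebra_measure_unique _ _ _ cylinders cylinders_measurable
  (fun=> setT) _ _ (mrestr P mXC) (mscale k P)) => //.
- by move=> _; exists (fun=> setT) => //; apply/seteqP; split.
- by rewrite bigcup_const//; exists 0%N.
- exact: cylinders_setI.
- by move=> A cA; have := cylinder_indep mC cA; rewrite setIC -Pk.
- by move=> _; rewrite -ge0_fin_numE// fin_num_measure.
Qed.

(** The variable [X b] is integrated first, with the value of [Y] frozen; a bound uniform in that
    value survives averaging over the law of [Y], which has mass 1. *)
Lemma integral_indep_le d' (T' : measurableType d') (Y : T -> T') (f : R * T' -> \bar R) :
  measurable_fun [set: g_sigma_algebraType cylinders] Y ->
  measurable_fun setT f -> (forall z, (0 <= f z)%E) ->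
  forall c : \bar R,
  (forall y, \int[distribution P (X b)]_x f (x, y) <= c)%E ->
  (\int[P]_w f (X b w, Y w) <= c)%E.
Proof.
move=> mY mf f0 c hc.
have sY B : measurable B -> <<s cylinders >> (Y @^-1` B).
  by move=> mB; have := mY measurableT _ mB; rewrite setTI.
(* Measurability passes from the sigma-algebra of the cylinders to the larger one of [T], where [Y]
   becomes a random variable. *)
have mYT : measurable_fun [set: T] Y.
  move=> _ B mB; rewrite setTI; move: (sY _ mB).
  by apply: smallest_sub => //; [exact: sigma_algebra_measurable|exact: cylinders_measurable].
pose Y' : {RV P >-> T'} := HB.pack Y (isMeasurableFun.Build _ _ _ _ _ mYT).
have hXY A B : measurable A -> measurable B ->
    P (X b @^-1` A `&` Y' @^-1` B) = (P (X b @^-1` A) * P (Y' @^-1` B))%E.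
  by move=> mA mB; apply: sigma_indep => //; exact: sY.
rewrite (integral_indep_pair (X := X b) (Y := Y') hXY mf f0).
apply: (@le_trans _ _ (\int[distribution P Y']_y c)%E); last first.
  by rewrite integral_cst//= probability_setT mule1.
apply: ge0_le_integral => //.
- by move=> y _; exact: integral_ge0.
- exact: (measurable_fun_fubini_tonelli_G (m1 := distribution P (X b)) _ mf f0).
Qed.

End Family.
End Independence.

(** * Gibbs means at fixed couplings and fields *)

Section Gibbs.
Variables (R : realType) (d : nat) (Lambda : {fset 'rV[R]_d}).
Implicit Types (beta : R) (J : bond Lambda -> R) (h : Lambda -> R).
Implicit Types (f : config Lambda -> R) (s : config Lambda) (e : bond Lambda).

Definition weight beta J h f : R :=
  \sum_(s : config Lambda) f s * expR (- beta * hamiltonian J h s).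

Definition bond_spin e s : R := \prod_(i in val e) spin s i.

Lemma gibbsE beta J h f : gibbs beta J h f = weight beta J h f / weight beta J h (fun=> 1).
Proof.
rewrite /gibbs /weight; congr (_ / _).
by under [RHS]eq_bigr do rewrite mul1r.
Qed.

Lemma weight_gt0 beta J h f s0 : (forall s, 0 <= f s) -> 0 < f s0 ->
  0 < weight beta J h f.
Proof.
move=> f0 fs0; rewrite /weight (bigD1 s0)//= ltr_wpDr//.
  by apply: sumr_ge0 => s _; rewrite mulr_ge0 ?expR_ge0.
by rewrite mulr_gt0 ?expR_gt0.
Qed.

Lemma weightD beta J h f g :
  weight beta J h (fun s => f s + g s) = weight beta J h f + weight beta J h g.
Proof. by rewrite /weight -big_split; apply: eq_bigr => s _; rewrite mulrDl. Qed.

Lemma weightZ beta J h a f :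
  weight beta J h (fun s => a * f s) = a * weight beta J h f.
Proof. by rewrite /weight mulr_sumr; apply: eq_bigr => s _; rewrite mulrA. Qed.

Lemma spin_sqr s i : spin s i * spin s i = 1 :> R.
Proof. by rewrite /spin; case: ifP => _; rewrite ?mulrNN mulr1. Qed.

Lemma neighbours_neq (i j : Lambda) : neighbours i j -> i != j.
Proof.
rewrite /neighbours; apply: contraTneq => ->.
rewrite subrr /enorm big1 ?sqrtr0 1?eq_sym ?oner_eq0// => k _.
by rewrite mxE expr0n.
Qed.

(** Passes from an ordered pair of sites to the unordered bond carrying the coupling; as [i] and [j]
    differ, the product over the bond has exactly two factors. *)
Lemma neighbours_bond (i j : Lambda) : neighbours i j ->
  exists e : bond Lambda, forall s, bond_spin e s = spin s i * spin s j.
Proof.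
move=> ij.
have be : is_bond [set i; j]%SET.
  by apply/existsP; exists i; apply/existsP; exists j; rewrite ij eqxx.
exists (exist (@is_bond _ _ _) [set i; j]%SET be) => s; rewrite /bond_spin /=.
by rewrite big_setU1 ?inE ?neighbours_neq// big_set1.
Qed.

Lemma bondP e : exists i j, neighbours i j /\ forall s, bond_spin e s = spin s i * spin s j.
Proof.
case: e => e; move=> /[dup] /existsP[i /existsP[j /andP[ij /eqP ->]]] be.
exists i, j; split=> // s; rewrite /bond_spin /=.
by rewrite big_setU1 ?inE ?neighbours_neq// big_set1.
Qed.

(* The hypotheses say that [u], [v], [w] are the means of A, B, AB for some
   random signs A, B. *)
Lemma sign_correlation (u v w : R) :
  0 <= 1 + u + v + w -> 0 <= 1 + u - v - w ->
  0 <= 1 - u + v - w -> 0 <= 1 - u - v + w ->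
  1 - w ^+ 2 <= (1 - u ^+ 2) + (1 - v ^+ 2).
Proof.
move=> h1 h2 h3 h4.
(* The hypotheses amount to |u + v| - 1 <= w <= 1 - |u - v|; the case split removes the absolute
   values. *)
have [|] := leP 0 (u + v); have [|] := leP 0 (u - v); nra.
Qed.

(** For a, b = 1 or -1 the function (1 + a A)(1 + b B) is nonnegative, hence so is its Gibbs mean;
    the four choices of (a, b) supply the four hypotheses of [sign_correlation]. *)
Lemma gibbs_sign_correlation beta J h (A B : config Lambda -> R) :
  (forall s, A s * A s = 1) -> (forall s, B s * B s = 1) ->
  1 - gibbs beta J h (fun s => A s * B s) ^+ 2 <=
  (1 - gibbs beta J h A ^+ 2) + (1 - gibbs beta J h B ^+ 2).
Proof.
move=> A1 B1.
have Z0 : 0 < weight beta J h (fun=> 1).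
  by apply: (@weight_gt0 _ _ _ _ [ffun=> true]).
have key a b : a ^+ 2 = 1 -> b ^+ 2 = 1 ->
    0 <= 1 + a * gibbs beta J h A + b * gibbs beta J h B
       + a * b * gibbs beta J h (fun s => A s * B s).
  move=> a1 b1.
  have -> : 1 + a * gibbs beta J h A + b * gibbs beta J h B
       + a * b * gibbs beta J h (fun s => A s * B s) =
     weight beta J h (fun s => (1 + a * A s) * (1 + b * B s)) / weight beta J h (fun=> 1).
    have -> : weight beta J h (fun s => (1 + a * A s) * (1 + b * B s)) =
      weight beta J h (fun=> 1) + a * weight beta J h A + b * weight beta J h B
      + a * b * weight beta J h (fun s => A s * B s).
      rewrite -!weightZ -!weightD; apply: eq_bigr => s _; congr (_ * _); ring.
    by rewrite !gibbsE; field; rewrite gt_eqF.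
  have sgn_ge0 (x : R) : x ^+ 2 = 1 -> 0 <= 1 + x by move=> x1; nra.
  apply: divr_ge0; last exact: ltW.
  apply: sumr_ge0 => s _; rewrite mulr_ge0 ?expR_ge0// mulr_ge0//;
    by apply: sgn_ge0; rewrite exprMn ?a1 ?b1 mul1r expr2 ?A1 ?B1.
apply: sign_correlation.
- by have := key 1 1 (expr1n _ _) (expr1n _ _); lra.
- by have := key 1 (-1) (expr1n _ _) (sqrr_sign _ 1); lra.
- by have := key (-1) 1 (sqrr_sign _ 1) (expr1n _ _); lra.
- by have := key (-1) (-1) (sqrr_sign _ 1) (sqrr_sign _ 1); lra.
Qed.

(** * Dependence of the Gibbs mean of a bond on its own coupling *)

Definition bond_off e J : bond Lambda -> R := fun e' => if e' == e then 0 else J e'.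

Lemma hamiltonian_bond_off e J h s :
  hamiltonian J h s = hamiltonian (bond_off e J) h s - J e * bond_spin e s.
Proof.
rewrite /hamiltonian (bigD1 e)//= [in RHS](bigD1 e)//= /bond_off eqxx mul0r add0r.
rewrite -/(bond_spin e s).
under [in RHS]eq_bigr => i /negPf -> do [].
by ring.
Qed.

(* Twice the additive constant [Y] in [<s_e> = tanh (beta * J e + Y)]. *)
Definition local_field beta J h e : R :=
  ln (weight beta (bond_off e J) h (fun s => 1 + bond_spin e s)) -
  ln (weight beta (bond_off e J) h (fun s => 1 - bond_spin e s)).

Lemma bond_spin_sqr e s : bond_spin e s * bond_spin e s = 1.
Proof.
by have [i [j [_ ->]]] := bondP e; rewrite mulrACA !spin_sqr mulr1.
Qed.

(** Makes both logarithms in [local_field] genuine. The bond spin is 1 when all spins are up, and -1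
    when only the endpoint [i] is up. *)
Lemma weight_bond_spin_gt0 beta J h e :
  0 < weight beta J h (fun s => 1 + bond_spin e s) /\
  0 < weight beta J h (fun s => 1 - bond_spin e s).
Proof.
have [i [j [ij es]]] := bondP e.
split.
- apply: (@weight_gt0 _ _ _ _ [ffun=> true]) => [s|]; first by have := bond_spin_sqr e s; nra.
  by rewrite es /spin !ffunE mulr1.
- apply: (@weight_gt0 _ _ _ _ [ffun k => k == i]) => [s|]; first by have := bond_spin_sqr e s; nra.
  rewrite es /spin !ffunE eqxx eq_sym (negPf (neighbours_neq ij)).
  by rewrite mul1r opprK.
Qed.

(** With u = exp (beta J_e), the mean of the bond spin is (u Zp - Zm / u) / (u Zp + Zm / u), which
    is tanh of half the logarithm of u^2 Zp / Zm. *)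
Lemma gibbs_bond_spin beta J h e :
  1 - gibbs beta J h (bond_spin e) ^+ 2 =
  4 * logistic_deriv (2 * beta * J e + local_field beta J h e).
Proof.
have [p0 m0] := weight_bond_spin_gt0 beta (bond_off e J) h e.
have sgn s : bond_spin e s = 1 \/ bond_spin e s = -1.
  by apply/pred2P; rewrite -sqrf_eq1 expr2 bond_spin_sqr.
(* With the bond switched off, [Zp] and [Zm] are twice the partition functions restricted to bond
   spin 1 and -1. *)
set Zp := weight _ _ _ _ in p0; set Zm := weight _ _ _ _ in m0.
(* Restoring the bond multiplies each Boltzmann factor by exp (beta J_e s_e), which is constant on
   each of the two restricted sums. *)
have tilt f : weight beta J h f = weight beta (bond_off e J) h
    (fun s => f s * expR (beta * J e * bond_spin e s)).
  apply: eq_bigr => s _; rewrite -mulrA; congr (_ * _).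
  by rewrite -expRD (hamiltonian_bond_off e); congr expR; ring.
pose u := expR (beta * J e).
have wp : weight beta J h (fun s => 1 + bond_spin e s) = u * Zp.
  rewrite tilt -weightZ; apply: eq_bigr => s _; congr (_ * _).
  by have [->|->] := sgn s; [rewrite mulr1 mulrC|rewrite subrr mul0r mulr0].
have wm : weight beta J h (fun s => 1 - bond_spin e s) = u^-1 * Zm.
  rewrite tilt -weightZ; apply: eq_bigr => s _; congr (_ * _).
  by have [->|->] := sgn s; [rewrite subrr mul0r mulr0|rewrite mulrN1 expRN mulrC].
have u0 : 0 < u := expR_gt0 _.
have w1 : weight beta J h (fun=> 1) = (u * Zp + u^-1 * Zm) / 2.
  rewrite -wp -wm -weightD mulrC -weightZ; apply: eq_bigr => s _; congr (_ * _).
  by field.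
have ws : weight beta J h (bond_spin e) = (u * Zp - u^-1 * Zm) / 2.
  rewrite -wp -wm -[X in _ - X]mul1r -mulNr -weightZ -weightD mulrC -weightZ.
  apply: eq_bigr => s _; congr (_ * _).
  by field.
have -> : 2 * beta * J e + local_field beta J h e = ln (u ^+ 2 * Zp / Zm).
  rewrite ln_div ?posrE ?mulr_gt0 ?exprn_gt0// lnM ?posrE ?exprn_gt0// lnXn//.
  by rewrite /u expRK /local_field -/Zp -/Zm; ring.
rewrite gibbsE w1 ws /logistic_deriv /logistic expRN lnK ?posrE ?divr_gt0 ?mulr_gt0 ?exprn_gt0//.
have D0 : 0 < u ^+ 2 * Zp + Zm by rewrite addr_gt0 ?mulr_gt0 ?exprn_gt0.
field.
by rewrite !gt_eqF.
Qed.

(** * Measurability in the couplings and fields *)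

Lemma measurable_weight dT (T : measurableType dT) beta
    (J : bond Lambda -> T -> R) (h : Lambda -> T -> R) f :
  (forall e, measurable_fun setT (J e)) -> (forall i, measurable_fun setT (h i)) ->
  measurable_fun setT (fun w => weight beta (J ^~ w) (h ^~ w) f).
Proof.
move=> mJ mh; apply: measurable_sum => s.
apply: measurable_funM => //; apply: measurableT_comp => //.
apply: measurable_funM => //; apply: measurable_funB.
- apply: measurableT_comp => //; apply: measurable_sum => e.
  exact: measurable_funM.
- by apply: measurable_sum => i; exact: measurable_funM.
Qed.

Lemma measurable_gibbs dT (T : measurableType dT) beta
    (J : bond Lambda -> T -> R) (h : Lambda -> T -> R) f :
  (forall e, measurable_fun setT (J e)) -> (forall i, measurable_fun setT (h i)) ->
  measurable_fun setT (fun w => gibbs beta (J ^~ w) (h ^~ w) f).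
Proof.
move=> mJ mh.
(* Division by the partition function Z > 0 becomes multiplication by exp (- ln Z), a composition of
   measurable maps. *)
have -> : (fun w => gibbs beta (J ^~ w) (h ^~ w) f) =
    (fun w => weight beta (J ^~ w) (h ^~ w) f *
              expR (- ln (weight beta (J ^~ w) (h ^~ w) (fun=> 1)))).
  apply/funext => w; rewrite gibbsE expRN lnK// posrE.
  exact: (@weight_gt0 _ _ _ _ [ffun=> true]).
apply: measurable_funM; first exact: measurable_weight.
apply: measurableT_comp => //; apply: measurableT_comp => //.
by apply: measurableT_comp; [exact: measurable_ln|exact: measurable_weight].
Qed.

(** Constraining only the couplings other than that of [e] allows the sigma-algebra generated by all
    variables except [J e] to be used on [T]; [bond_off] replaces [J e] by the constant 0. *)
Lemma measurable_local_field dT (T : measurableType dT) beta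
    (J : bond Lambda -> T -> R) (h : Lambda -> T -> R) e :
  (forall e', e' != e -> measurable_fun setT (J e')) ->
  (forall i, measurable_fun setT (h i)) ->
  measurable_fun setT (fun w => local_field beta (J ^~ w) (h ^~ w) e).
Proof.
move=> mJ mh.
have mo e' : measurable_fun setT (fun w => bond_off e (J ^~ w) e').
  by rewrite /bond_off; case: eqP => [_|/eqP /mJ//].
by apply: measurable_funB;
  (apply: measurableT_comp; [exact: measurable_ln|exact: measurable_weight]).
Qed.

End Gibbs.

(** * Comparison of Gaussian averages with Lebesgue integrals *)

(** The density is bounded by its peak, so the normal law is dominated, as a measure, by Lebesgue
    measure scaled by [normal_peak s]. *)
Lemma normal_integral_le (R : realType) (s : R) (f : R -> \bar R) :
  s != 0 -> measurable_fun setT f -> (forall x, (0 <= f x)%E) ->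
  (\int[normal_prob 0 s]_x f x <=
   (normal_peak s)%:E * \int[lebesgue_measure]_x f x)%E.
Proof.
move=> s0 mf f0.
pose k := NngNum (normal_peak_ge0 s).
rewrite -[(normal_peak s)]/(k%:num) -ge0_integral_mscale//.
apply: ge0_le_measure_integral => //= A mA.
rewrite /mscale /= /normal_prob -integral_cst//.
apply: ge0_le_integral => //=.
- by move=> x _; rewrite lee_fin normal_pdf_ge0.
- by apply/measurable_funTS/measurable_EFinP; exact: measurable_normal_pdf.
- by move=> x _; rewrite lee_fin normal_pdf_ub.
Qed.

Lemma integral_gaussian_le (R : realType) disp (T : measurableType disp)
    (P : probability T R) (X : {RV P >-> R}) (s : R) (f : R -> \bar R) :
  0 < s -> centered_gaussian s X ->
  measurable_fun setT f -> (forall x, (0 <= f x)%E) ->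
  (\int[distribution P X]_x f x <=
   (normal_peak s)%:E * \int[lebesgue_measure]_x f x)%E.
Proof.
move=> s0 gX mf f0.
apply: le_trans (@normal_integral_le R s f _ _ _) => //; last by rewrite gt_eqF.
(* [normal_prob] lives on [measurableTypeR R], which has the same sigma-algebra
   as [R] but another display. *)
have mid : @measurable_fun _ _ (measurableTypeR R) R setT id.
  by move=> mT A mA; rewrite setTI.
pose N : {measure set R -> \bar R} := pushforward (normal_prob 0 s) (id : measurableTypeR R -> R).
rewrite (@eq_measure_integral _ R R setT (N mid)); last first.
  by move=> A mA _; have := gX A mA; rewrite gt_eqF.
by rewrite /N ge0_integral_pushforward.
Qed.

(** * Averages over the disorder for one bond and for two bonds *)

Section BondAverages.
Variables (R : realType) (d : nat) (Lambda : {fset 'rV[R]_d}).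
Variables (beta Delta : R) (disp : measure_display) (T : measurableType disp).
Variables (P : probability T R).
Variables (J : bond Lambda -> {RV P >-> R}) (h : Lambda -> {RV P >-> R}).
Hypotheses (beta0 : 0 < beta) (Delta0 : 0 < Delta).
Hypothesis gJ : forall e, centered_gaussian Delta (J e).
Hypothesis indJh : mutually_independent (join_families J h).

(** With the local field frozen at y, the average over [J e] is at most the peak times the Lebesgue
    integral of [4 * logistic_deriv (2 * beta * x + y)], which is 4 / (2 beta) for every y. *)
Lemma expectation_bond_variance e :
  (\int[P]_w (1 - gibbs beta (J ^~ w) (h ^~ w) (bond_spin e) ^+ 2)%:E <=
   (2 * normal_peak Delta / beta)%:E)%E.
Proof.
pose Y w := local_field beta (J ^~ w) (h ^~ w) e.
pose f (z : R * R) : \bar R := (4 * logistic_deriv (2 * beta * z.1 + z.2))%:E.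
under eq_integral do rewrite gibbs_bond_spin.
have b20 : 0 < 2 * beta by rewrite mulr_gt0.
have mderiv : measurable_fun setT (@logistic_deriv R).
  by apply: continuous_measurable_fun; exact: continuous_logistic_deriv.
(* The coupling [J e] sits at index [inl e] of the joint family; [Y] is a function of the remaining
   couplings and all fields. *)
apply: (@integral_indep_le _ _ _ _ _ _ indJh (inl e) _ _ Y f).
- apply: measurable_local_field => [e' ee'|i].
    exact: (@measurable_cylinder _ _ _ P _ (join_families J h) (inl e) (inl e')).
  exact: (@measurable_cylinder _ _ _ P _ (join_families J h) (inl e) (inr i)).
- apply/measurable_EFinP; apply: measurable_funM => //.
  apply: measurableT_comp => //; apply: measurable_funD => //.
  by apply: measurable_funM.
- by move=> z; rewrite lee_fin mulr_ge0 ?logistic_deriv_ge0.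
- move=> y; rewrite /f /=.
  have fm : measurable_fun setT (fun x : R => logistic_deriv (2 * beta * x + y)).
    by apply: measurableT_comp => //; apply: measurable_funD => //.
  under eq_integral do rewrite EFinM.
  rewrite ge0_integralZl//; last 2 first.
  + exact/measurable_EFinP.
  + by move=> x _; rewrite lee_fin logistic_deriv_ge0.
  apply: (@le_trans _ _ (4%:E * ((normal_peak Delta)%:E * ((2 * beta)^-1)%:E))%E).
    rewrite lee_pmul2l//.
    rewrite -(integral_logistic_deriv y b20); apply: integral_gaussian_le => //.
    * exact/measurable_EFinP.
    * by move=> x; rewrite lee_fin logistic_deriv_ge0.
  rewrite -!EFinM lee_fin le_eqVlt; apply/orP; left; apply/eqP.
  by field; rewrite gt_eqF.
Qed.

Lemma gibbs_sqr_le1 J' h' e : gibbs beta J' h' (bond_spin (Lambda := Lambda) (R := R) e) ^+ 2 <= 1.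
Proof. by rewrite -subr_ge0 gibbs_bond_spin mulr_ge0 ?logistic_deriv_ge0. Qed.

(** The pointwise inequality 1 <= W + V_e + V_e' is integrated and each V is bounded by the one-bond
    estimate; the bonds may be far apart, share a site or coincide. *)
Lemma expectation_two_bonds e e' :
  ((1 - 4 * normal_peak Delta / beta)%:E <=
   \int[P]_w (gibbs beta (J ^~ w) (h ^~ w)
      (fun s => bond_spin e s * bond_spin e' s) ^+ 2)%:E)%E.
Proof.
pose V e w := 1 - gibbs beta (J ^~ w) (h ^~ w) (bond_spin e) ^+ 2.
pose W w := gibbs beta (J ^~ w) (h ^~ w) (fun s => bond_spin e s * bond_spin e' s) ^+ 2.
have mJ e0 : measurable_fun setT (J e0) by [].
have mh i : measurable_fun setT (h i) by [].
have mW : measurable_fun setT W.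
  by apply: measurable_funX; exact: measurable_gibbs.
have mV e0 : measurable_fun setT (V e0).
  by apply: measurable_funB => //; apply: measurable_funX; exact: measurable_gibbs.
have V0 e0 w : 0 <= V e0 w by rewrite subr_ge0 gibbs_sqr_le1.
have W0 w : 0 <= W w by exact: sqr_ge0.
(* Kept as a sum of nonnegative integrals, so that additivity holds without integrability
   conditions. *)
have H : (1%:E <= \int[P]_w (W w)%:E + (\int[P]_w (V e w)%:E + \int[P]_w (V e' w)%:E))%E.
  have e0 (f : T -> R) : (forall w, 0 <= f w) -> forall w, setT w -> (0 <= (f w)%:E)%E.
    by move=> f0 w _; rewrite lee_fin.
  have me (f : T -> R) : measurable_fun setT f -> measurable_fun setT (fun w => (f w)%:E).
    by move=> mf; exact/measurable_EFinP.
  have mVV : measurable_fun setT (fun w => V e w + V e' w) by exact: measurable_funD.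
  have VV0 w : 0 <= V e w + V e' w by rewrite addr_ge0.
  have addE (f g : T -> R) : measurable_fun setT f -> measurable_fun setT g ->
      (forall w, 0 <= f w) -> (forall w, 0 <= g w) ->
      (\int[P]_w (f w)%:E + \int[P]_w (g w)%:E = \int[P]_w (f w + g w)%:E)%E.
    move=> mf mg f0 g0; rewrite -ge0_integralD//; first exact: e0.
    - exact: me.
    - exact: e0.
    - exact: me.
  rewrite !addE//.
  rewrite -[X in (X <= _)%E](_ : \int[P]_w 1%:E = 1%:E)%E; last first.
    by rewrite integral_cst//= probability_setT mule1.
  apply: ge0_le_integral => //.
  + by apply/measurable_EFinP; apply: measurable_funD => //; exact: measurable_funD.
  + move=> w _; rewrite lee_fin -lerBlDl.
    by apply: gibbs_sign_correlation; exact: bond_spin_sqr.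
have := le_trans H (leeD2l _ (leeD (expectation_bond_variance e) (expectation_bond_variance e'))).
rewrite -EFinD -leeBlDr// -EFinB; apply: le_trans.
by rewrite lee_fin; lra.
Qed.

End BondAverages.

(** * The explicit constant and the conclusion *)

(** Identifies the constant 4 [normal_peak Delta] of the two-bond estimate with b1. *)
Lemma normal_peak_sqrt (R : realType) (s : R) : 0 < s ->
  4 * normal_peak s = 2 / s * Num.sqrt (2 / pi).
Proof.
move=> s0; rewrite /normal_peak.
move: pi (pi_gt0 R) => p p0.
have q0 : 0 < Num.sqrt (p * 2) by rewrite sqrtr_gt0 mulr_gt0.
have -> : Num.sqrt (s ^+ 2 * p *+ 2) = s * Num.sqrt (p * 2).
  rewrite -[_ *+ 2]mulr_natr -[_ * _ * _]mulrA.
  by rewrite sqrtrM ?sqr_ge0// sqrtr_sqr gtr0_norm.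
have -> : Num.sqrt (2 / p) = 2 / Num.sqrt (p * 2).
  have -> : 2 / p = 2 ^+ 2 / (p * 2) by field; rewrite gt_eqF.
  by rewrite sqrtrM ?sqr_ge0// sqrtr_sqr gtr0_norm// sqrtrV// mulr_ge0// ltW.
by field; rewrite !gt_eqF.
Qed.

Theorem theorem2 (R : realType) (d : nat)
    (B E : 'M[R]_d) (a b : 'rV[R]_d) (Lambda : {fset 'rV[R]_d})
    (beta Delta Gamma : R)
    (disp : measure_display) (T : measurableType disp) (P : probability T R)
    (J : bond Lambda -> {RV P >-> R}) (h : Lambda -> {RV P >-> R}) :
  B \in unitmx -> unit_spacing (lattice B) ->
  E \in unitmx -> [set` Lambda] = lattice B `&` box E a b ->
  0 < beta -> 0 < Delta -> 0 <= Gamma ->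
  (forall e, centered_gaussian Delta (J e)) ->
  (forall i, centered_gaussian Gamma (h i)) ->
  mutually_independent (join_families J h) ->
  let omega (w : T) : (config Lambda -> R) -> R :=
    gibbs beta (fun e => J e w) (fun i => h i w) in
  let b1 := 2 / Delta * Num.sqrt (2 / pi) in
  let b3 := 1 / (Num.sqrt (2 * pi) * Delta ^+ 3) in
  forall i j k l : Lambda, neighbours i j -> neighbours k l ->
  ((1 - b1 / beta - b3 / beta ^+ 3)%:E <=
   'E_P[fun w => (omega w (fun s => (spin s i * spin s j) *
                                    (spin s k * spin s l)) ^+ 2)%R])%E.
Proof.
move=> _ _ _ _ beta0 Delta0 _ gJ _ indJh omega b1 b3 i j k l ij kl.
have [e es] := neighbours_bond ij; have [e' es'] := neighbours_bond kl.
have -> : (fun s => (spin s i * spin s j) * (spin s k * spin s l)) =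
    (fun s => bond_spin e s * bond_spin e' s).
  by apply/funext => s; rewrite es es'.
rewrite unlock.
apply: le_trans (expectation_two_bonds beta0 Delta0 gJ indJh e e').
(* What remains is that the b3 term is nonnegative, so subtracting it only lowers the bound. *)
rewrite lee_fin normal_peak_sqrt// -/b1 gerBl.
by rewrite divr_ge0 ?exprn_ge0 ?ltW// divr_gt0// mulr_gt0 ?exprn_gt0// sqrtr_gt0 mulr_gt0 ?pi_gt0.
Qed.
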